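(* Let $X$ be $\mathbb{R}^n$, or a Riemannian manifold (not necessarily finite-dimensional), or a Banach space, let $U\subseteq X$ be open and convex, and let $k\in\mathbb{N}\cup\{\infty\}$. Assume that $U=\bigcup_{n=1}^{\infty}B_n$, where the $B_n$ are open bounded convex sets such that $\mathrm{dist}(B_n,\partial U)>0$ and $\overline{B_n}\subset B_{n+1}$ for each $n$. Assume also that every continuous convex function $f:U\to\mathbb{R}$ can be approximated from below by $C^k$ convex (resp. $C^k$ strongly convex) functions, uniformly on bounded subsets of $U$. Then every continuous convex function $f:U\to\mathbb{R}$ can be approximated from below by $C^k$ convex (resp. $C^k$ strongly convex) functions, uniformly on $U$; that is, for every continuous convex $f:U\to\mathbb{R}$ and every $\varepsilon>0$ there is a $C^k$ convex (resp. $C^k$ strongly convex) function $g:U\to\mathbb{R}$ with $f-\varepsilon\leq g\leq f$ on $U$.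
   Context: Approximation on bounded subsets: a continuous convex function $f:U\to\mathbb{R}$ can be approximated from below by $C^k$ convex (resp. strongly convex) functions, uniformly on bounded subsets of $U$, if for every bounded set $B\subseteq U$ with $\mathrm{dist}(B,\partial U)>0$ and every $\varepsilon>0$ there is a $C^k$ convex (resp. strongly convex) function $g:U\to\mathbb{R}$ such that $g\leq f$ on $U$ and $f-\varepsilon\leq g$ on $B$. If $U=X$, one sets $\mathrm{dist}(B,\partial U)=\infty$ for every bounded $B$. Distances are the norm distance or the Riemannian distance. Convexity: in a Riemannian manifold a function is convex if its composition with every geodesic segment contained in its domain is convex; in $\mathbb{R}^n$ or a Banach space, geodesics are straight lines. Strong convexity: a $C^2$ function $\varphi$ is strongly convex if its second derivative along any nonconstant geodesic is strictly positive everywhere on the geodesic. A not necessarily smooth function $f$ is strongly convex if for every point $p$ of its domain and every $C^\infty$ strongly convex function $\varphi$ defined on a neighborhood of $p$ there is $\varepsilon>0$ such that $f-\varepsilon\varphi$ is convex on some neighborhood of $p$. *)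

(* Defs.v *)
From HB Require Import structures.
From mathcomp Require Import all_boot all_order all_algebra.
From mathcomp Require Import all_classical all_reals all_analysis.

Set Implicit Arguments.
Unset Strict Implicit.
Unset Printing Implicit Defensive.

Import Order.TTheory GRing.Theory Num.Theory.
Import numFieldNormedType.Exports.

Local Open Scope ring_scope.
Local Open Scope classical_set_scope.

(* C^n maps between normed spaces, in the sense of Frechet, on an open set A.
   The derivatives of all orders are gathered in one map D: for a list vs of
   length j, D x vs is the value D^j f(x)[vs] of the j-th derivative, an element
   of the space L^j(E; F) of bounded j-linear maps. The inequalities below are
   those of the operator norm of L^j(E; F), and they say that, for j < n, D^j f
   is Frechet differentiable as a map A -> L^j(E; F), with differential
   h |-> D^(j+1) f(x)[h, .], and that D^n f : A -> L^n(E; F) is continuous. *)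
Definition cont_diffn (R : realType) (E F : normedModType R) (n : nat)
    (A : set E) (f : E -> F) : Prop :=
  exists D : E -> seq E -> F,
    [/\ forall x, A x -> D x [::] = f x,
        forall x, A x -> forall (s1 s2 : seq E) (a : R) (u v : E),
          (size s1 + size s2 < n)%N ->
          D x (s1 ++ (a *: u + v) :: s2) =
            a *: D x (s1 ++ u :: s2) + D x (s1 ++ v :: s2),
        forall x, A x -> forall j, (j <= n)%N ->
          exists C : R, forall vs : seq E, size vs = j ->
            `|D x vs| <= C * \prod_(v <- vs) `|v|,
        forall x, A x -> forall j, (j < n)%N -> forall e : R, 0 < e ->
          \forall h \near (0 : E), forall vs : seq E, size vs = j ->
            `|D (x + h) vs - D x vs - D x (h :: vs)|
              <= e * `|h| * \prod_(v <- vs) `|v|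
      & forall x, A x -> forall e : R, 0 < e ->
          \forall y \near x, forall vs : seq E, size vs = n ->
            `|D y vs - D x vs| <= e * \prod_(v <- vs) `|v|].

(* Smoothness orders k in {0, 1, 2, ...} \cup {oo}; None stands for oo. *)
Definition cont_diff (R : realType) (E F : normedModType R) (k : option nat)
    (A : set E) (f : E -> F) : Prop :=
  if k is Some n then cont_diffn n A f else forall n, cont_diffn n A f.

(* What the statement uses of the ambient space. A member gamma of
   geodesic a b is a map defined on all of R of which only the restriction to
   [a, b] (and to its germ at a and b) is meant. *)
Record geometry (R : realType) := Geometry {
  carrier :> topologicalType;
  gdist : carrier -> carrier -> \bar R;
  geodesic : R -> R -> set (R -> carrier);
  Ck : option nat -> set carrier -> (carrier -> R) -> Prop
}.

Definition banach_geometry (R : realType) (E : completeNormedModType R) :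
    geometry R :=
  @Geometry R E
    (fun x y => `|x - y|%:E)
    (fun _ _ => [set gamma | exists x v : E, forall t, gamma t = x + t *: v])
    (fun k A f => cont_diff k A f).

(* The library norm on 'rV[R]_n is the sup norm, which has the same topology
   and the same C^k functions as the Euclidean one. *)
Definition euclidean_geometry (R : realType) (n : nat) : geometry R :=
  @Geometry R 'rV[R]_n
    (fun x y => (Num.sqrt (\sum_(i < n) (x ord0 i - y ord0 i) ^+ 2))%:E)
    (fun _ _ => [set gamma | exists x v : 'rV[R]_n,
       forall t, gamma t = x + t *: v])
    (fun k A f => cont_diff k A f).

(* C^oo Riemannian manifolds, possibly infinite-dimensional. The metric induces
   on each tangent space a norm equivalent to that of the model space E, which
   is therefore Hilbertizable.
   metric i x u v is g_p(u, v), where p = chart_inv i x and where tangent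
   vectors at p are read in the chart i. It is a smooth function of
   (x, u, v) exactly when x |-> metric i x is smooth into the bounded bilinear
   forms. *)
Record riemannian_manifold (R : realType) := RiemannianManifold {
  points :> topologicalType;
  model : completeNormedModType R;
  atlas : Type;
  dom : atlas -> set points;
  cod : atlas -> set model;
  chart : atlas -> points -> model;
  chart_inv : atlas -> model -> points;
  metric : atlas -> model -> model -> model -> R;
  points_hausdorff : hausdorff_space points;
  dom_open : forall i, open (dom i);
  cod_open : forall i, open (cod i);
  dom_cover : forall p, exists i, dom i p;
  chart_cod : forall i p, dom i p -> cod i (chart i p);
  chart_inv_dom : forall i x, cod i x -> dom i (chart_inv i x);
  chartK : forall i p, dom i p -> chart_inv i (chart i p) = p;
  chart_invK : forall i x, cod i x -> chart i (chart_inv i x) = x;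
  chart_continuous : forall i, {within dom i, continuous (chart i)};
  chart_inv_continuous : forall i, {within cod i, continuous (chart_inv i)};
  transition_smooth : forall i j,
    cont_diff None (cod i `&` chart_inv i @^-1` dom j) (chart j \o chart_inv i);
  metric_linear : forall i x, cod i x -> forall (a : R) u v w,
    metric i x (a *: u + v) w = a * metric i x u w + metric i x v w;
  metric_sym : forall i x, cod i x -> forall u v,
    metric i x u v = metric i x v u;
  metric_norm : forall i x, cod i x -> exists c C : R,
    0 < c /\ forall u, c * `|u| ^+ 2 <= metric i x u u <= C * `|u| ^+ 2;
  metric_smooth : forall i,
    cont_diff None [set z : model * model * model | cod i z.1.1]
      (fun z : model * model * model => metric i z.1.1 z.1.2 z.2 : R);
  metric_transition : forall i j x, cod i x -> dom j (chart_inv i x) ->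
    forall u v, metric i x u v =
      metric j (chart j (chart_inv i x))
        ('d (chart j \o chart_inv i) x u) ('d (chart j \o chart_inv i) x v)
}.

Section riemannian.
Variables (R : realType) (M : riemannian_manifold R).

(* The geodesic equation g(c'', w) + Gamma(c', c'; w) = 0 in every chart, where
   Gamma(u, v; w) = (D_u g(v, w) + D_v g(u, w) - D_w g(u, v)) / 2 are the
   Christoffel symbols of the first kind. *)
Definition geodesic_at (gamma : R -> M) (t : R) : Prop :=
  {for t, continuous gamma} /\
  forall i, dom i (gamma t) ->
    let c : R -> model M := chart i \o gamma in
    let c' := c^`() in let c'' := c^`(2) in
    [/\ \forall s \near t, derivable c s 1,
        derivable c' t 1
      & forall w : model M,
          metric i (c t) (c'' t) w
          + 'D_(c' t) (fun x => metric i x (c' t) w : R) (c t)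
          - 2^-1 * 'D_w (fun x => metric i x (c' t) (c' t) : R) (c t) = 0].

(* A geodesic parametrized by [a, b] extends to a neighbourhood of [a, b]. *)
Definition riemannian_geodesic (a b : R) : set (R -> M) :=
  [set gamma | forall t, `[a, b]%classic t ->
     \forall s \near t, geodesic_at gamma s].

Definition C1_segment (a b : R) (gamma : R -> M) : Prop :=
  forall t, `[a, b]%classic t -> \forall s \near t,
    {for s, continuous gamma} /\
    forall i, dom i (gamma s) ->
      derivable (chart i \o gamma) s 1 /\
      {for s, continuous (chart i \o gamma)^`()}.

Definition speed_on (a b : R) (gamma : R -> M) (v : R -> R) : Prop :=
  forall t, `[a, b]%classic t -> forall i, dom i (gamma t) ->
    let c : R -> model M := chart i \o gamma in
    let c' := c^`() in
    v t = Num.sqrt (metric i (c t) (c' t) (c' t)).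

(* path_length x y l : some piecewise C^1 path from x to y has length l. *)
Inductive path_length : M -> M -> \bar R -> Prop :=
| path_length_nil (x : M) : path_length x x 0%E
| path_length_cons (a b : R) (gamma : R -> M) (v : R -> R) (y : M) (l : \bar R) :
    a < b -> C1_segment a b gamma -> speed_on a b gamma v ->
    path_length (gamma b) y l ->
    path_length (gamma a) y
      (\int[lebesgue_measure]_(t in `[a, b]) (v t)%:E + l)%E.

Definition riemannian_dist (x y : M) : \bar R :=
  ereal_inf [set l | path_length x y l].

Definition riemannian_Ck (k : option nat) (A : set M) (f : M -> R) : Prop :=
  forall i, cont_diff k (cod i `&` chart_inv i @^-1` A) (f \o chart_inv i).

Definition riemannian_geometry : geometry R :=
  @Geometry R M riemannian_dist riemannian_geodesic riemannian_Ck.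

End riemannian.

Inductive ambient (R : realType) : Type :=
| Euclidean of nat
| Riemannian of riemannian_manifold R
| Banach of completeNormedModType R.

Definition ambient_geometry (R : realType) (X : ambient R) : geometry R :=
  match X with
  | Euclidean n => euclidean_geometry R n
  | Riemannian M => riemannian_geometry M
  | Banach E => banach_geometry E
  end.
Coercion ambient_geometry : ambient >-> geometry.

Section convexity.
Variables (R : realType) (X : geometry R).
Implicit Types (U B : set X) (f g : X -> R) (k : option nat).

Definition geodesically_convex U : Prop :=
  forall x y, U x -> U y -> exists a b gamma,
    [/\ a <= b, geodesic a b gamma, gamma a = x, gamma b = y
      & forall t, `[a, b]%classic t -> U (gamma t)].

Definition bounded_subset U : Prop :=
  exists r : R, forall x y, U x -> U y -> (gdist x y <= r%:E)%E.

Definition frontier U : set X := closure U `\` interior U.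

(* Equal to +oo when one of the sets is empty. *)
Definition set_dist U B : \bar R :=
  ereal_inf [set gdist x y | x in U & y in B].

Definition convex_on U f : Prop :=
  forall a b gamma, geodesic a b gamma ->
    (forall t, `[a, b]%classic t -> U (gamma t)) ->
    convex_function (`[a, b]%classic : set R) (f \o gamma).

(* Strong convexity on the open set U of a function of class C^2. *)
Definition strongly_convex_C2 U f : Prop :=
  forall a b gamma, geodesic a b gamma ->
    (forall t, `[a, b]%classic t -> U (gamma t)) ->
    (exists s t, [/\ `[a, b]%classic s, `[a, b]%classic t
                   & gamma s <> gamma t]) ->
    forall t, `[a, b]%classic t ->
      [/\ \forall s \near t, derivable (f \o gamma) s 1,
          derivable (f \o gamma)^`() t 1
        & 0 < (f \o gamma)^`(2) t].

(* Strong convexity on the open set U of a function not assumed smooth. *)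
Definition strongly_convex_weak U f : Prop :=
  forall p, U p -> forall (V : set X) (phi : X -> R),
    open V -> V p -> Ck None V phi -> strongly_convex_C2 V phi ->
    exists e : R, 0 < e /\ exists W : set X,
      [/\ open W, W p, W `<=` U `&` V
        & convex_on W (fun x => f x - e * phi x)].

(* In infinite dimension the two notions differ for C^2 functions; the first
   one is used as soon as the class C^k consists of C^2 functions. *)
Definition strongly_convex k U f : Prop :=
  if k is Some (0 | 1)%N then strongly_convex_weak U f
  else strongly_convex_C2 U f.

Variant convexity := Convex | StronglyConvex.

Definition Ck_convex (c : convexity) k U g : Prop :=
  Ck k U g /\
  match c with
  | Convex => convex_on U g
  | StronglyConvex => strongly_convex k U g
  end.

Definition approximable_from_below_on_bounded (c : convexity) k U f : Prop :=
  forall B, B `<=` U -> bounded_subset B -> (0 < set_dist B (frontier U))%E ->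
  forall e : R, 0 < e ->
  exists g, [/\ Ck_convex c k U g,
                forall x, U x -> g x <= f x
              & forall x, B x -> f x - e <= g x].

Definition approximable_from_below_uniformly (c : convexity) k U f : Prop :=
  forall e : R, 0 < e ->
  exists g, Ck_convex c k U g /\ forall x, U x -> f x - e <= g x <= f x.

End convexity.

(* Main.v *)
Require Import Defs.
From HB Require Import structures.
From mathcomp Require Import all_boot all_order all_algebra.
From mathcomp Require Import all_classical all_reals all_analysis.
From mathcomp Require Import ring lra.

Set Implicit Arguments.
Unset Strict Implicit.
Unset Printing Implicit Defensive.

Import Order.TTheory GRing.Theory Num.Theory.
Import numFieldNormedType.Exports.
Local Open Scope ring_scope.
Local Open Scope classical_set_scope.

(* With q n = e / 2^n, let h n approximate f - (e - q n) from below, with error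
   q n / 4 on B n, and glue the h n by g (n + 1) = M (g n) (h (n + 1)), where M
   is a smooth maximum: M x y = x as soon as x >= y + q n / 4, and
   max x y <= M x y <= max x (y + q n / 4). On B n the function g n beats
   h (n + 1) by the margin q n / 4, so g (n + 1) = g n there and the g n
   stabilize to the required function.
   M x y = x + d * chi (1 + (y - x) / d) with d = q n / 4, where
   chi s = s * exp (-1 / s) for s > 0 and 0 elsewhere. It is a supremum of affine
   functions (1 - l) x + l y + k with 0 <= l <= 1, hence it preserves convexity
   along every curve. It also commutes with adding a constant to both arguments,
   which gives the preservation of strong convexity without smoothness. *)

(** * Directional derivatives from first-order expansions *)

Lemma is_derive_littleo (R : realType) (E : normedModType R) (f : E -> R)
    (x v : E) (L : E -> R) :
  (forall a u, L (a *: u) = a * L u) ->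
  (forall e : R, 0 < e ->
    \forall h \near (0 : E), `|f (x + h) - f x - L h| <= e * `|h|) ->
  is_derive x v f (L v).
Proof.
move=> LZ Hf.
have cvf : (fun h : R => h^-1 *: (f (h *: v + x) - f x)) @ (0:R)^' --> L v.
  apply/cvgrPdist_le => e e0.
  (* The summand 1 keeps the denominator positive when v = 0. *)
  have e1 : 0 < e / (1 + `|v|) by rewrite divr_gt0// ltr_pwDl.
  have cv0 : (fun h : R => h *: v) @ (0:R)^' --> (0 : E).
    apply: cvg_within_filter; rewrite -(scale0r v).
    by apply: cvgZr_tmp; exact: cvg_id.
  have := cv0 _ (Hf _ e1); rewrite /= near_simpl => H.
  near=> h.
  have h0 : h != 0 by near: h; exact: nbhs_dnbhs_neq.
  have : `|f (x + h *: v) - f x - L (h *: v)| <= e / (1 + `|v|) * `|h *: v|.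
    by near: h.
  rewrite LZ normrZ => Hh.
  (* By homogeneity of L, the gap to the difference quotient is, up to sign, the remainder at
     [h *: v] divided by h. *)
  have -> : L v - h^-1 *: (f (h *: v + x) - f x) =
      - (h^-1 * (f (x + h *: v) - f x - h * L v)).
    by rewrite -[_ *: (_ - _)]/(_ * _) (addrC x); field.
  rewrite normrN.
  rewrite normrM normfV ler_pdivrMl ?normr_gt0// (le_trans Hh)//.
  rewrite mulrCA ler_wpM2l// mulrAC ler_pdivrMr ?ltr_pwDl//.
  by rewrite ler_wpM2l// ?(ltW e0)// lerDr.
by split; [apply/cvg_ex; exists (L v)|exact/cvg_lim].
Unshelve. all: by end_near. Qed.

(** * Functions flat at 0 and the smooth convex ramp [chi] *)

Section flat.
Variable R : realType.
Implicit Types (p : {poly R}) (s t : R).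

(** This class is closed under differentiation, p being replaced by X^2 (p - p'), and it contains
    all derivatives of [chi] of order at least 1. *)
Definition flat p s : R := if 0 < s then p.[s^-1] * expR (- s^-1) else 0.

(** The power t^n is carried along for the induction on p: peeling off the constant term c of p X +
    c raises the exponent attached to p by one, and |c| t^n is at most |c| n! exp t by the
    exponential series. *)
Lemma poly_le_expR p n :
  exists C, forall t, 0 <= t -> `|p.[t] * t ^+ n| <= C * expR t.
Proof.
elim/poly_ind: p n => [|p c IH] n.
  by exists 0 => t _; rewrite horner0 !mul0r normr0.
have [C HC] := IH n.+1; exists (C + `|c| * n`!%:R) => t t0.
rewrite hornerMXaddC mulrDl -mulrA -exprS (le_trans (ler_normD _ _))//.
rewrite mulrDl lerD ?HC// normrM -mulrA ler_wpM2l// ger0_norm ?exprn_ge0//.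
case: n {C HC IH} => [|n]; first by rewrite expr0 mul1r -expR0 ler_expR.
have := expR_ge1Dxn n t0.
have f0 : (0 : R) < n.+1`!%:R by rewrite ltr0n fact_gt0.
move=> H; rewrite mulrC -ler_pdivrMr//; apply: le_trans H.
by rewrite lerDr.
Qed.

(** The growth bound at t = 1/s with exponent 2. Quadratic decay is what makes the derivative at 0
    vanish. *)
Lemma flat_le_sqr p : exists2 C, 0 <= C & forall s, `|flat p s| <= C * s ^+ 2.
Proof.
have [C HC] := poly_le_expR p 2.
have C0 : 0 <= C by have := HC 0 (lexx _); rewrite expR0 mulr1; apply: le_trans.
exists C => // s; rewrite /flat; case: ifPn => [s0|_]; last first.
  by rewrite normr0 mulr_ge0// sqr_ge0.
have si : 0 <= s^-1 by rewrite invr_ge0 ltW.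
have := HC _ si; rewrite normrM [X in _ * X <= _]ger0_norm ?exprn_ge0// => H.
rewrite normrM [`|expR _|]ger0_norm ?expR_ge0// expRN.
by rewrite ler_pdivrMr ?expR_gt0// mulrAC -ler_pdivrMr ?exprn_gt0// -exprVn.
Qed.

(** Chain rule on the right of 0, local constancy on the left; at 0 the quadratic bound gives
    derivative 0, which is also the value at 0 of the claimed derivative. *)
Lemma is_derive_flat p s :
  is_derive s 1 (flat p) (flat ('X^2 * (p - p^`())) s).
Proof.
have [s0|s0|<-] := ltgtP 0 s.
- have H : is_derive s 1 (fun t => p.[t^-1] * expR (- t^-1))
      (flat ('X^2 * (p - p^`())) s).
    have iV : is_derive s 1 (fun t => t^-1) (- s ^- 2).
      have H := @derivableV _ _ id s 1 (lt0r_neq0 s0) (@derivable_id _ _ _ _).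
      have E := @deriveV _ _ id s 1 (lt0r_neq0 s0) (@derivable_id _ _ _ _).
      rewrite derive_id in E.
      apply: (DeriveDef H); rewrite [LHS]E.
      by rewrite -[_ *: _]/(_ * _) mulr1.
    have iP := @is_derive1_comp _ _ _ _ _ _ (is_derive_poly p s^-1) iV.
    have iE := @is_derive1_comp _ expR (- (@GRing.inv R)) s _ _
      (is_derive_expR (- s^-1)) (is_deriveN iV).
    have iM := is_deriveM iP iE.
    apply: (is_derive_eq iM); rewrite /flat s0 /= !hornerE.
    rewrite -![_ *: _]/(_ * _).
    rewrite -[(- GRing.inv) s]/(- s^-1) -exprVn; ring.
  apply: near_eq_is_derive H.
  near=> t; rewrite /flat ifT//; near: t; exact: lt_nbhsr.
- have -> : flat ('X^2 * (p - p^`())) s = 0 by rewrite /flat ltNge ltW.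
  apply: (@near_eq_is_derive _ _ _ (cst 0)).
  near=> t; rewrite /flat ltNge ltW//; near: t; exact: lt_nbhsl.
- have -> : flat ('X^2 * (p - p^`())) 0 = 0 by rewrite /flat ltxx.
  have [C C0 HC] := flat_le_sqr p.
  apply: (@is_derive_littleo _ R^o _ _ _ (fun=> 0)) => [a _|e e0].
    by rewrite mulr0.
  near=> h.
  rewrite add0r [flat p 0]/flat ltxx !subr0 (le_trans (HC h))//.
  rewrite -real_normK ?num_real// expr2 mulrA ler_wpM2r//.
  have : `|h| <= e / (1 + C).
    near: h; apply: (@nbhs0_le _ R^o); rewrite divr_gt0//; exact: ltr_pwDl.
  rewrite ler_pdivlMr ?ltr_pwDl// => /(le_trans _); apply.
  by rewrite mulrC ler_wpM2l// lerDr.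
Unshelve. all: by end_near. Qed.

(** A smooth convex substitute for the positive part, lying between max 0 (s - 1) and max 0 s, with
    slope in [0, 1]. *)
Definition chi s : R := s * flat 1 s.

Lemma chi_gt0E s : 0 < s -> chi s = s * expR (- s^-1).
Proof. by move=> s0; rewrite /chi /flat s0 hornerC mul1r. Qed.

Lemma chi_le0E s : s <= 0 -> chi s = 0.
Proof. by move=> s0; rewrite /chi /flat ltNge s0 mulr0. Qed.

Lemma chi_ge0 s : 0 <= chi s.
Proof.
case: (leP s 0) => s0; first by rewrite chi_le0E.
by rewrite chi_gt0E// mulr_ge0 ?expR_ge0 ?ltW.
Qed.

(** For s > 0, multiply exp (-1/s) >= 1 - 1/s by s. *)
Lemma chi_ge_sub1 s : s - 1 <= chi s.
Proof.
case: (leP s 0) => s0; first by rewrite chi_le0E//; lra.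
rewrite chi_gt0E//; have := expR_ge1Dx (- s^-1).
by rewrite -(ler_pM2l s0) mulrDr mulr1 mulrN divff ?gt_eqF.
Qed.

Lemma chi_le_max s : chi s <= Num.max 0 s.
Proof.
rewrite le_max; case: (leP s 0) => s0; first by rewrite chi_le0E// lexx.
rewrite chi_gt0E// ler_piMr ?orbT// ?(ltW s0)//.
by rewrite expR_le1 oppr_le0 invr_ge0 ltW.
Qed.

(** [dchi_poly k] encodes the derivative of order k + 1, starting from chi' s = (1 + 1/s) exp
    (-1/s). The function [chi] itself is not of the form [flat p], hence the separate first case of
    [dchi]. *)
Fixpoint dchi_poly k : {poly R} :=
  if k is k'.+1 then 'X^2 * (dchi_poly k' - (dchi_poly k')^`()) else 1 + 'X.

Definition dchi k : R -> R := if k is k'.+1 then flat (dchi_poly k') else chi.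

Lemma is_derive_dchi k s : is_derive s 1 (dchi k) (dchi k.+1 s).
Proof.
case: k => [|k]; last exact: is_derive_flat.
have iM := is_deriveM (is_derive_id s (1 : R)) (is_derive_flat 1 s).
apply: (is_derive_eq iM); rewrite /= /flat; case: ifPn => s0; last first.
  by rewrite scaler0 scale0r addr0.
rewrite -![_ *: _]/(_ * _) derivC subr0 mulr1 !hornerE.
rewrite -[X in X + _]/(s / s / s * expR (- s^-1)) divff ?gt_eqF//.
by rewrite mul1r mulrDl mul1r addrC.
Qed.

Lemma dchi1_gt0E s : 0 < s -> dchi 1 s = (1 + s^-1) * expR (- s^-1).
Proof. by move=> s0; rewrite /= /flat s0 !hornerE. Qed.

(** The upper bound is 1 + 1/s <= exp (1/s). This slope will be the weight of a convex
    combination. *)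
Lemma dchi1_itv s : 0 <= dchi 1 s <= 1.
Proof.
case: (leP s 0) => s0; first by rewrite /= /flat ltNge s0 lexx ler01.
have si : 0 < s^-1 by rewrite invr_gt0.
rewrite dchi1_gt0E// mulr_ge0 ?expR_ge0 ?addr_ge0 ?(ltW si)//=.
by rewrite expRN ler_pdivrMr ?expR_gt0// mul1r expR_ge1Dx.
Qed.

(** The polynomial simplifies to X^3, so chi'' s = s^-3 exp (-1/s) for s > 0. *)
Lemma dchi2_ge0 s : 0 <= dchi 2 s.
Proof.
rewrite /= /flat; case: ifPn => // s0.
have si : 0 < s^-1 by rewrite invr_gt0.
rewrite derivD derivC derivX add0r addrAC subrr add0r !hornerE.
by rewrite mulr_ge0 ?expR_ge0// mulr_ge0 ?exprn_ge0// ltW.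
Qed.

(** For s, r > 0, multiplying by exp (1/s) reduces the claim to r (1 + x) <= r exp x with x = 1/s -
    1/r. For r <= 0 < s the tangent line is already nonpositive. *)
Lemma chi_tangent s r : chi s + dchi 1 s * (r - s) <= chi r.
Proof.
case: (leP s 0) => s0.
  rewrite chi_le0E//= /flat ltNge s0 mul0r addr0; exact: chi_ge0.
have si : 0 < s^-1 by rewrite invr_gt0.
have -> : chi s + dchi 1 s * (r - s) =
    expR (- s^-1) * ((1 + s^-1) * r - 1).
  by rewrite chi_gt0E// dchi1_gt0E//; field; rewrite gt_eqF.
case: (leP r 0) => r0.
  rewrite (le_trans _ (chi_ge0 r))// mulr_ge0_le0 ?expR_ge0//.
  by rewrite subr_le0 (le_trans _ ler01)// mulr_ge0_le0// addr_ge0// ltW.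
rewrite chi_gt0E// -(ler_pM2l (expR_gt0 s^-1)) mulrA expRxMexpNx_1 mul1r.
rewrite mulrCA -expRD.
have := expR_ge1Dx (s^-1 - r^-1); rewrite -(ler_pM2l r0); apply: le_trans.
by rewrite le_eqVlt (_ : _ == _)//; apply/eqP; field; rewrite gt_eqF//= gt_eqF.
Qed.

End flat.

(** * Families of functions of class C^n with uniform estimates *)

Section uniformly_differentiable_families.
Variables (R : realType) (E : normedModType R).

(* The family (f_i) is of class C^n on A, all the estimates of bounds, moduli
   of continuity and differentiability being uniform in i relatively to the
   weights w_i. The multilinear maps D^j f are read as families indexed by
   lists of vectors, the weight of a list being the product of the norms: this
   turns the Leibniz rule into an induction with binary products only. *)
Fixpoint family_diffn (A : set E) (n : nat) :
    forall I : Type, (I -> R) -> (I -> E -> R) -> Prop :=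
  fun I w f =>
  (forall x, A x -> exists C : R, forall i, `|f i x| <= C * w i) /\
  match n with
  | 0 => forall x, A x -> forall e : R, 0 < e ->
      \forall h \near (0 : E), forall i, `|f i (x + h) - f i x| <= e * w i
  | n'.+1 =>
    [/\ forall x, A x -> forall i (a : R) u v,
          'D_(a *: u + v) (f i) x = a * 'D_u (f i) x + 'D_v (f i) x,
        forall x, A x -> forall e : R, 0 < e ->
          \forall h \near (0 : E), forall i,
            `|f i (x + h) - f i x - 'D_h (f i) x| <= e * `|h| * w i
      & @family_diffn A n' (I * E)%type (fun p => w p.1 * `|p.2|)
          (fun p => 'D_(p.2) (f p.1))]
  end.

Lemma near_add0 (x : E) (P : set E) :
  (\forall y \near x, P y) <-> (\forall h \near (0 : E), P (x + h)).
Proof.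
by rewrite (near_shift 0); split; apply: filterS => h /=; rewrite subr0 addrC.
Qed.

Lemma open_near0 (A : set E) x : open A -> A x ->
  \forall h \near (0 : E), A (x + h).
Proof.
by move=> oA Ax; apply/(near_add0 x A); apply: open_nbhs_nbhs; split.
Qed.

Lemma eq_derive_open (A : set E) (f g : E -> R) v : open A ->
  (forall x, A x -> f x = g x) -> forall x, A x -> 'D_v f x = 'D_v g x.
Proof.
move=> oA fg x Ax; apply: near_eq_derive.
by apply: filterS (open_nbhs_nbhs (conj oA Ax)).
Qed.

(** Successive derivatives and products produce index types that are nested pairs in various orders;
    this lemma rearranges them. *)
Lemma family_diffn_reindex (A : set E) n (I J : Type) (w : I -> R)
    (w' : J -> R) (f : I -> E -> R) (phi : J -> I) :
  (forall j, w' j = w (phi j)) ->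
  family_diffn A n w f -> family_diffn A n w' (fun j => f (phi j)).
Proof.
elim: n I J w w' f phi => [|n IH] I J w w' f phi ww' [Hb H]; split.
- by move=> x /Hb[C HC]; exists C => j; rewrite ww'.
- move=> x Ax e e0; have := H x Ax e e0.
  by apply: filterS => h + j => /(_ (phi j)); rewrite ww'.
- by move=> x /Hb[C HC]; exists C => j; rewrite ww'.
- have [Hl Hd Hf] := H; split.
  + by move=> x Ax j a u v; exact: Hl.
  + move=> x Ax e e0; have := Hd x Ax e e0.
    by apply: filterS => h + j => /(_ (phi j)); rewrite ww'.
  + apply: (IH _ _ _ _ _ (fun p : J * E => (phi p.1, p.2))) Hf => -[j v] /=.
    by rewrite ww'.
Qed.

Lemma eq_family_diffn (A : set E) n (I : Type) (w : I -> R)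
    (f g : I -> E -> R) :
  open A -> (forall i x, A x -> f i x = g i x) ->
  family_diffn A n w f -> family_diffn A n w g.
Proof.
move=> oA; elim: n I w f g => [|n IH] I w f g fg [Hb H]; split.
- by move=> x Ax; have [C HC] := Hb x Ax; exists C => i; rewrite -fg.
- move=> x Ax e e0.
  apply: filterS2 (open_near0 oA Ax) (H x Ax e e0) => h Axh + i => /(_ i).
  by rewrite !fg.
- by move=> x Ax; have [C HC] := Hb x Ax; exists C => i; rewrite -fg.
- have [Hl Hd Hf] := H.
  have Dfg v i x : A x -> 'D_v (f i) x = 'D_v (g i) x.
    by move=> Ax; apply: eq_derive_open Ax => // y; exact: fg.
  split.
  + by move=> x Ax i a u v; rewrite -!Dfg//; exact: Hl.
  + move=> x Ax e e0.
    apply: filterS2 (open_near0 oA Ax) (Hd x Ax e e0) => h Axh + i => /(_ i).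
    by rewrite !fg// Dfg.
  + by apply: IH Hf => -[i v] x Ax /=; exact: Dfg.
Qed.

(** Each clause of the definition concerns one point of A, and ['D_v] does not refer to A. *)
Lemma family_diffn_local (A : set E) n (I : Type) (w : I -> R)
    (f : I -> E -> R) :
  (forall x, A x -> exists2 V, V x & family_diffn V n w f) ->
  family_diffn A n w f.
Proof.
elim: n I w f => [|n IH] I w f H; split.
- by move=> x /H[V Vx [Hb _]]; exact: Hb.
- by move=> x /H[V Vx [_ Hc]]; exact: Hc.
- by move=> x /H[V Vx [Hb _]]; exact: Hb.
- split.
  + by move=> x /H[V Vx [_ [Hl _ _]]]; exact: Hl.
  + by move=> x /H[V Vx [_ [_ Hd _]]]; exact: Hd.
  + by apply: IH => x /H[V Vx [_ [_ _ Hf]]]; exists V.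
Qed.

Section equidifferentiability.
Variables (A : set E) (I : Type) (w : I -> R).
Hypothesis w0 : forall i, 0 <= w i.

(** Introduction rule: the remainder estimate identifies an explicit candidate [df] with ['D_v], in
    terms of which the fixpoint is written. *)
Lemma family_diffnS n (f : I -> E -> R) (df : I -> E -> E -> R) :
  open A ->
  (forall x, A x -> exists C : R, forall i, `|f i x| <= C * w i) ->
  (forall x, A x -> forall i (a : R) u v,
    df i (a *: u + v) x = a * df i u x + df i v x) ->
  (forall x, A x -> forall e : R, 0 < e ->
    \forall h \near (0 : E), forall i,
      `|f i (x + h) - f i x - df i h x| <= e * `|h| * w i) ->
  family_diffn A n (fun p : I * E => w p.1 * `|p.2|) (fun p => df p.1 p.2) ->
  family_diffn A n.+1 w f.
Proof.
move=> oA Hb Hl Hd Hf.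
have DE i v x : A x -> 'D_v (f i) x = df i v x.
  move=> Ax.
  have L0 : df i 0 x = 0.
    by have := Hl x Ax i (- 1) 0 0; rewrite scaler0 addr0 mulN1r addNr.
  have LZ a u : df i (a *: u) x = a * df i u x.
    by have := Hl x Ax i a u 0; rewrite addr0 L0 addr0.
  have [] // := @is_derive_littleo _ _ (f i) x v (fun h => df i h x) LZ _.
  move=> e e0.
  (* For a fixed i, the factor 1 + w i absorbs the weight in the uniform estimate. *)
  have e1 : 0 < e / (1 + w i) by rewrite divr_gt0// ltr_pwDl.
  have := Hd x Ax _ e1; apply: filterS => h /(_ i) /le_trans; apply.
  rewrite mulrAC ler_wpM2r// mulrAC ler_pdivrMr ?ltr_pwDl//.
  by rewrite ler_wpM2l ?(ltW e0)// lerDr.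
split=> //; split.
- by move=> x Ax i a u v; rewrite !DE//; exact: Hl.
- move=> x Ax e e0; have := Hd x Ax e e0.
  by apply: filterS => h + i => /(_ i); rewrite DE.
- by apply: eq_family_diffn Hf => // -[i v] x Ax /=; rewrite DE.
Qed.

Lemma family_diffn_is_derive n (f : I -> E -> R) i x v :
  family_diffn A n.+1 w f -> A x -> is_derive x v (f i) ('D_v (f i) x).
Proof.
move=> [_ [Hl Hd _]] Ax.
have L0 : 'D_0 (f i) x = 0 by exact: derive0.
have LZ a u : 'D_(a *: u) (f i) x = a * 'D_u (f i) x.
  by have := Hl x Ax i a u 0; rewrite addr0 L0 addr0.
apply: (@is_derive_littleo _ _ (f i) x v (fun h => 'D_h (f i) x) LZ).
move=> e e0.
have e1 : 0 < e / (1 + w i) by rewrite divr_gt0// ltr_pwDl.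
have := Hd x Ax _ e1; apply: filterS => h /(_ i) /le_trans; apply.
rewrite mulrAC ler_wpM2r// mulrAC ler_pdivrMr ?ltr_pwDl//.
by rewrite ler_wpM2l ?(ltW e0)// lerDr.
Qed.

Lemma family_diffn_bounded n (f : I -> E -> R) x :
  family_diffn A n w f -> A x ->
  exists2 C : R, 0 <= C & forall i, `|f i x| <= C * w i.
Proof.
move=> H Ax; have [C HC] : exists C : R, forall i, `|f i x| <= C * w i.
  by case: n H => [|n] [Hb _]; exact: Hb.
exists `|C| => // i; rewrite (le_trans (HC i))// ler_wpM2r//.
exact: ler_norm.
Qed.

End equidifferentiability.

(** For n > 0, the remainder estimate with tolerance 1 and the bound C on the differentials give an
    increment of at most (1 + C) |h| w_i. *)
Lemma family_diffn_equicontinuous (A : set E) n (I : Type) (w : I -> R)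
    (f : I -> E -> R) x (e : R) :
  (forall i, 0 <= w i) -> family_diffn A n w f -> A x -> 0 < e ->
  \forall h \near (0 : E), forall i, `|f i (x + h) - f i x| <= e * w i.
Proof.
case: n => [|n] w0 H Ax e0; first by have [_ ] := H; apply.
have [_ [_ Hd Hf]] := H.
have wp0 (p : I * E) : 0 <= w p.1 * `|p.2| by rewrite mulr_ge0.
have [C C0 HC] := family_diffn_bounded wp0 Hf Ax.
have Hd1 := Hd x Ax 1 ltr01; near=> h => i.
have h1 : `|h| <= e / (1 + C).
  by near: h; apply: (@nbhs0_le _ E); rewrite divr_gt0// ltr_pwDl.
have K : `|f i (x + h) - f i x - 'D_h (f i) x| <= 1 * `|h| * w i.
  by move: i; near: h.
rewrite -(subrK ('D_h (f i) x) (f i (x + h) - f i x)).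
rewrite (le_trans (ler_normD _ _))//.
rewrite (le_trans (lerD K (HC (i, h))))//= mul1r mulrCA (mulrC `|h|) -mulrDr.
rewrite mulrC ler_wpM2r//; move: h1; rewrite ler_pdivlMr ?ltr_pwDl//.
by rewrite mulrDr mulr1 (mulrC C).
Unshelve. all: by end_near. Qed.

Lemma family_diffnW (A : set E) n (I : Type) (w : I -> R) (f : I -> E -> R) :
  (forall i, 0 <= w i) -> family_diffn A n.+1 w f -> family_diffn A n w f.
Proof.
elim: n I w f => [|n IH] I w f w0 H.
  split; first by have [] := H.
  move=> x Ax e; exact: family_diffn_equicontinuous H Ax.
have [Hb [Hl Hd Hf]] := H.
by split => //; split => //; apply: IH => // p; rewrite mulr_ge0.
Qed.

Lemma family_diffnD (A : set E) n (I : Type) (w : I -> R)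
    (f g : I -> E -> R) : open A -> (forall i, 0 <= w i) ->
  family_diffn A n w f -> family_diffn A n w g ->
  family_diffn A n w (fun i x => f i x + g i x).
Proof.
move=> oA; elim: n I w f g => [|n IH] I w f g w0 Hf Hg.
  split=> [x Ax|x Ax e e0].
    have [C _ HC] := family_diffn_bounded w0 Hf Ax.
    have [C' _ HC'] := family_diffn_bounded w0 Hg Ax.
    exists (C + C') => i; rewrite (le_trans (ler_normD _ _))// mulrDl.
    by rewrite lerD.
  have e2 : 0 < e / 2 by rewrite divr_gt0.
  have := family_diffn_equicontinuous w0 Hf Ax e2.
  have := family_diffn_equicontinuous w0 Hg Ax e2.
  apply: filterS2 => h H1 H2 i; rewrite opprD addrACA.
  rewrite (le_trans (ler_normD _ _))// (le_trans (lerD (H2 i) (H1 i)))//.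
  by rewrite -mulrDl -splitr.
have [Hfb [Hfl Hfd Hff]] := Hf; have [Hgb [Hgl Hgd Hgf]] := Hg.
apply: (@family_diffnS _ _ _ _ _ _ (fun i v x => 'D_v (f i) x + 'D_v (g i) x))
  => //.
- move=> x Ax; have [C HC] := Hfb x Ax; have [C' HC'] := Hgb x Ax.
  exists (C + C') => i; rewrite (le_trans (ler_normD _ _))// mulrDl.
  by rewrite lerD.
- by move=> x Ax i a u v; rewrite Hfl// Hgl// mulrDr addrACA.
- move=> x Ax e e0; have e2 : 0 < e / 2 by rewrite divr_gt0.
  have := Hfd x Ax _ e2; have := Hgd x Ax _ e2.
  apply: filterS2 => h H1 H2 i.
  rewrite (_ : _ - _ - _ = (f i (x + h) - f i x - 'D_h (f i) x) +
    (g i (x + h) - g i x - 'D_h (g i) x)); last by ring.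
  rewrite (le_trans (ler_normD _ _))// (le_trans (lerD (H2 i) (H1 i)))//.
  by rewrite -2!mulrDl -splitr.
- by apply: IH => // p; rewrite mulr_ge0.
Qed.

End uniformly_differentiable_families.

(** * Leibniz and chain rules for families *)

Lemma is_derive1_littleo (R : realType) (c : R -> R) (a dc e : R) :
  is_derive a 1 c dc -> 0 < e ->
  \forall b \near a, `|c b - c a - dc * (b - a)| <= e * `|b - a|.
Proof.
move=> [/cvg_ex[l cl] <-] e0.
have <- : l = 'D_1 c a by apply/esym/cvg_lim.
have /cvgrPdist_le/(_ e e0) := cl.
rewrite /dnbhs near_withinE /= => H.
apply/(near_add0 (E := R^o) a
  (fun b : R => `|c b - c a - l * (b - a)| <= e * `|b - a|)).
move: H; apply: filterS => h H; rewrite (addrC a) addrK.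
have [->|h0] := eqVneq h 0.
  by rewrite add0r subrr mulr0 subr0 normr0 mulr0.
have := H h0; rewrite -[_ *: (_ - _)]/(_ * _) -[h *: 1]/(h * 1) mulr1 => K.
have -> : c (h + a) - c a - l * h = - ((l - h^-1 * (c (h + a) - c a)) * h).
  by field.
by rewrite normrN normrM ler_wpM2r.
Qed.

Section products_and_compositions.
Variables (R : realType) (E : normedModType R).

(** A single tolerance for a sum of errors of total weight K. The bound e' <= 1 allows a product of
    two small quantities to be estimated by one of them. *)
Let small (e K : R) : 0 < e -> 0 <= K ->
  exists e', [/\ 0 < e', e' <= 1 & e' * K <= e].
Proof.
move=> e0 K0; exists (e / (e + K)).
have eK : 0 < e + K by rewrite ltr_pwDl.
split; first by rewrite divr_gt0.
  by rewrite ler_pdivrMr// mul1r lerDl.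
by rewrite mulrAC ler_pdivrMr// ler_wpM2l ?(ltW e0)// lerDr ltW.
Qed.

(** Leibniz rule: the derivative is a sum of two families, each the product of one family and the
    derivative of the other. The induction hypothesis applies to both once [family_diffnW] has
    lowered the order of the undifferentiated factor. *)
Lemma family_diffnM (A : set E) n (I J : Type) (w : I -> R) (w' : J -> R)
    (f : I -> E -> R) (g : J -> E -> R) :
  open A -> (forall i, 0 <= w i) -> (forall j, 0 <= w' j) ->
  family_diffn A n w f -> family_diffn A n w' g ->
  family_diffn A n (fun p : I * J => w p.1 * w' p.2)
    (fun p x => f p.1 x * g p.2 x).
Proof.
move=> oA; elim: n I J w w' f g => [|n IH] I J w w' f g w0 w'0 Hf Hg.
  split=> [x Ax|x Ax e e0].
    have [C C0 HC] := family_diffn_bounded w0 Hf Ax.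
    have [C' C'0 HC'] := family_diffn_bounded w'0 Hg Ax.
    by exists (C * C') => -[i j] /=; rewrite normrM mulrACA ler_pM.
  have [C C0 HC] := family_diffn_bounded w0 Hf Ax.
  have [C' C'0 HC'] := family_diffn_bounded w'0 Hg Ax.
  have [|e1 [e10 e11 e1e]] := @small e (C + 1 + C') e0.
    by rewrite !addr_ge0.
  apply: filterS2 (family_diffn_equicontinuous w0 Hf Ax e10)
    (family_diffn_equicontinuous w'0 Hg Ax e10) => h Hfh Hgh [i j] /=.
  have -> : f i (x + h) * g j (x + h) - f i x * g j x =
      f i x * (g j (x + h) - g j x) +
      (f i (x + h) - f i x) * (g j (x + h) - g j x) +
      (f i (x + h) - f i x) * g j x by ring.
  have : C * w i * (e1 * w' j) + e1 * w i * (1 * w' j) + e1 * w i * (C' * w' j)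
      <= e * (w i * w' j).
    rewrite (_ : _ + _ = e1 * (C + 1 + C') * (w i * w' j)); last by ring.
    by rewrite ler_wpM2r// mulr_ge0.
  apply: le_trans.
  rewrite (le_trans (ler_normD _ _))// lerD//; last by rewrite normrM ler_pM.
  rewrite (le_trans (ler_normD _ _))// lerD// normrM ler_pM//.
  by rewrite (le_trans (Hgh j))// ler_wpM2r.
have [Hfb [Hfl Hfd Hff]] := Hf; have [Hgb [Hgl Hgd Hgf]] := Hg.
have ww0 (p : I * J) : 0 <= w p.1 * w' p.2 by rewrite mulr_ge0.
have wE0 (p : I * E) : 0 <= w p.1 * `|p.2| by rewrite mulr_ge0.
have w'E0 (p : J * E) : 0 <= w' p.1 * `|p.2| by rewrite mulr_ge0.
apply: (@family_diffnS _ _ _ _ _ _ _ _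
  (fun p v x => f p.1 x * 'D_v (g p.2) x + 'D_v (f p.1) x * g p.2 x)) => //.
- move=> x Ax; have [C C0 HC] := family_diffn_bounded w0 Hf Ax.
  have [C' C'0 HC'] := family_diffn_bounded w'0 Hg Ax.
  by exists (C * C') => -[i j] /=; rewrite normrM mulrACA ler_pM.
- by move=> x Ax [i j] a u v /=; rewrite Hfl// Hgl//; ring.
- move=> x Ax e e0; have [C C0 HC] := family_diffn_bounded w0 Hf Ax.
  have [C' C'0 HC'] := family_diffn_bounded w'0 Hg Ax.
  have [K K0 HK] := family_diffn_bounded w'E0 Hgf Ax.
  (* One constant for each of the four terms into which the error is split below; K bounds the
     differential of g. *)
  have [|e1 [e10 e11 e1e]] := @small e (C + 1 + K + C') e0.
    by rewrite !addr_ge0.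
  apply: filterS3 (family_diffn_equicontinuous w0 Hf Ax e10) (Hfd x Ax _ e10)
    (Hgd x Ax _ e10) => h Hch Hfh Hgh [i j] /=.
  set r := g j (x + h) - g j x - 'D_h (g j) x.
  have -> : f i (x + h) * g j (x + h) - f i x * g j x -
      (f i x * 'D_h (g j) x + 'D_h (f i) x * g j x) =
      f i x * r + (f i (x + h) - f i x) * r +
      (f i (x + h) - f i x) * 'D_h (g j) x +
      (f i (x + h) - f i x - 'D_h (f i) x) * g j x by rewrite /r; ring.
  have : C * w i * (e1 * `|h| * w' j) + e1 * w i * (1 * `|h| * w' j) +
      e1 * w i * (K * (w' j * `|h|)) + e1 * `|h| * w i * (C' * w' j) <=
      e * `|h| * (w i * w' j).
    rewrite (_ : _ + _ = e1 * (C + 1 + K + C') * (`|h| * (w i * w' j)));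
      last by ring.
    by rewrite -[leRHS]mulrA ler_wpM2r// !mulr_ge0.
  apply: le_trans.
  rewrite (le_trans (ler_normD _ _))// lerD//; last by rewrite normrM ler_pM.
  rewrite (le_trans (ler_normD _ _))// lerD//; last first.
    by rewrite normrM ler_pM//; exact: (HK (j, h)).
  rewrite (le_trans (ler_normD _ _))// lerD// normrM ler_pM// /r.
    exact: Hgh.
  by rewrite (le_trans (Hgh j))// ler_wpM2r// ler_wpM2r.
- refine (@family_diffnD _ _ A n _ _
    (fun (p : I * J * E) x => f p.1.1 x * 'D_(p.2) (g p.1.2) x)
    (fun p x => 'D_(p.2) (f p.1.1) x * g p.1.2 x) oA _ _ _).
  + by move=> p; rewrite mulr_ge0.
  + have := IH _ _ _ _ _ _ w0 w'E0 (family_diffnW w0 Hf) Hgf.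
    apply: (@family_diffn_reindex _ _ _ _ _ _ _ _ _
      (fun p : I * J * E => (p.1.1, (p.1.2, p.2)))) => p /=.
    by rewrite mulrA.
  + have := IH _ _ _ _ _ _ wE0 w'0 Hff (family_diffnW w'0 Hg).
    apply: (@family_diffn_reindex _ _ _ _ _ _ _ _ _
      (fun p : I * J * E => ((p.1.1, p.2), p.1.2))) => p /=.
    by rewrite mulrAC.
Qed.

(** The derivative is the product of [c k.+1] composed with u and of the derivative of u, so the
    induction, general in k, proceeds by [family_diffnM]. *)
Lemma family_diffn_comp (A : set E) n (c : nat -> R -> R) (u : E -> R) k :
  open A -> (forall k (s : R), is_derive s 1 (c k) (c k.+1 s)) ->
  family_diffn A n (fun _ : unit => 1) (fun=> u) ->
  family_diffn A n (fun _ : unit => 1) (fun _ x => c k (u x)).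
Proof.
move=> oA Hc; elim: n k => [|n IH] k Hu.
  split=> [x Ax|x Ax e e0]; first by exists `|c k (u x)| => _; rewrite mulr1.
  have cc : {for u x, continuous (c k)}.
    by apply/differentiable_continuous/derivable1_diffP; have [] := Hc k (u x).
  have /cvgrPdist_le/(_ e e0) := cc.
  rewrite near_simpl => /nbhs_ballP[d /= d0 Hd].
  have d2 : 0 < d / 2 by rewrite divr_gt0.
  apply: filterS (family_diffn_equicontinuous (fun=> ler01) Hu Ax d2) => h H i.
  rewrite mulr1 distrC; apply: Hd; rewrite /ball /= distrC.
  by rewrite (le_lt_trans (H i))// mulr1 ltr_pdivrMr// ltr_pMr// ltr1n.
have [Hub [Hul Hud Huf]] := Hu.
apply: (@family_diffnS _ _ _ _ _ _ _ _
  (fun _ v x => c k.+1 (u x) * 'D_v u x)) => //.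
- by move=> x Ax; exists `|c k (u x)| => _; rewrite mulr1.
- by move=> x Ax i a v v' /=; rewrite (Hul x Ax tt)//; ring.
- move=> x Ax e e0.
  have wE0 (p : unit * E) : 0 <= 1 * `|p.2| :> R by rewrite mul1r.
  have [K K0 HK] := family_diffn_bounded wE0 Huf Ax.
  (* Since e1 <= 1, the increment of u is at most (K + 1) |h|; the last summand weighs the remainder
     of u. *)
  have [|e1 [e10 e11 e1e]] := @small e (K + 1 + `|c k.+1 (u x)|) e0.
    by rewrite !addr_ge0.
  have /nbhs_ballP[d /= d0 Hd] := is_derive1_littleo (Hc k (u x)) e10.
  have d2 : 0 < d / 2 by rewrite divr_gt0.
  apply: filterS2 (family_diffn_equicontinuous (fun=> ler01) Hu Ax d2)
    (Hud x Ax _ e10) => h Hch /(_ tt) Huh i.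
  have bd : ball (u x) d (u (x + h)).
    rewrite /ball /= distrC (le_lt_trans (Hch tt))// mulr1.
    by rewrite ltr_pdivrMr// ltr_pMr// ltr1n.
  have := Hd _ bd; rewrite /= => H.
  set r := u (x + h) - u x - 'D_h u x.
  rewrite -/r mulr1 in Huh; rewrite mulr1.
  have rE : u (x + h) - u x = 'D_h u x + r by rewrite /r; ring.
  have : e1 * (K * (1 * `|h|) + 1 * `|h|) + `|c k.+1 (u x)| * (e1 * `|h|) <=
      e * `|h|.
    rewrite (_ : _ + _ = e1 * (K + 1 + `|c k.+1 (u x)|) * `|h|); last by ring.
    by rewrite ler_wpM2r.
  apply: le_trans.
  have -> : c k (u (x + h)) - c k (u x) - c k.+1 (u x) * 'D_h u x =
     (c k (u (x + h)) - c k (u x) - c k.+1 (u x) * (u (x + h) - u x)) +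
     c k.+1 (u x) * r by rewrite /r; ring.
  rewrite (le_trans (ler_normD _ _))// lerD//; last by rewrite normrM ler_wpM2l.
  rewrite (le_trans H)// ler_wpM2l ?(ltW e10)// rE.
  rewrite (le_trans (ler_normD _ _))// lerD//; first exact: (HK (tt, h)).
  by rewrite (le_trans Huh)// ler_wpM2r.
- have wE0 (p : unit * E) : 0 <= 1 * `|p.2| :> R by rewrite mul1r.
  have := family_diffnM oA (fun=> ler01) wE0
    (IH k.+1 (family_diffnW (fun=> ler01) Hu)) Huf.
  apply: (@family_diffn_reindex _ _ _ _ _ _ _ _ _
    (fun p : unit * E => (tt, (tt, p.2)))) => p /=.
  by rewrite !mul1r.
Qed.

End products_and_compositions.

(** * Equivalence of the family formulation with [cont_diffn] *)

Section iterated_directional_derivatives.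
Variables (R : realType) (E : normedModType R).

(** Induction on the number m of derivatives left: differentiating the values of D on lists of
    length j prepends a vector. The map [phi] parametrizes the lists by the current index type. *)
Lemma cont_diffn_family (A : set E) n (D : E -> seq E -> R) :
  open A ->
  (forall x, A x -> forall (s1 s2 : seq E) (a : R) (u v : E),
    (size s1 + size s2 < n)%N ->
    D x (s1 ++ (a *: u + v) :: s2) =
      a * D x (s1 ++ u :: s2) + D x (s1 ++ v :: s2)) ->
  (forall x, A x -> forall j, (j <= n)%N ->
    exists C : R, forall vs : seq E, size vs = j ->
      `|D x vs| <= C * \prod_(v <- vs) `|v|) ->
  (forall x, A x -> forall j, (j < n)%N -> forall e : R, 0 < e ->
    \forall h \near (0 : E), forall vs : seq E, size vs = j ->
      `|D (x + h) vs - D x vs - D x (h :: vs)|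
        <= e * `|h| * \prod_(v <- vs) `|v|) ->
  (forall x, A x -> forall e : R, 0 < e ->
    \forall y \near x, forall vs : seq E, size vs = n ->
      `|D y vs - D x vs| <= e * \prod_(v <- vs) `|v|) ->
  forall (I : Type) (phi : I -> seq E) m j, (m + j = n)%N ->
    (forall i, size (phi i) = j) ->
    family_diffn A m (fun i => \prod_(v <- phi i) `|v|)
      (fun i x => D x (phi i)).
Proof.
move=> oA Dlin Dbnd Ddiff Dcont I phi m.
elim: m I phi => [|m IH] I phi j mj sphi.
  rewrite add0n in mj; split=> [x Ax|x Ax e e0].
    have [|C HC] := Dbnd x Ax j; first by rewrite mj.
    by exists C => i; exact: HC.
  have /near_add0 := Dcont x Ax e e0.
  by apply: filterS => h + i; apply; rewrite sphi.
apply: (@family_diffnS _ _ _ _ _ _ _ _ (fun i v x => D x (v :: phi i))) => //.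
- by move=> i; exact: prodr_ge0.
- move=> x Ax; have [|C HC] := Dbnd x Ax j; first by rewrite -mj leq_addl.
  by exists C => i; exact: HC.
- move=> x Ax i a u v; rewrite -(cat0s (_ :: _)) Dlin// add0n sphi -mj.
  by rewrite addSn ltnS leq_addl.
- move=> x Ax e e0; have jn : (j < n)%N by rewrite -mj addSn ltnS leq_addl.
  by apply: filterS (Ddiff x Ax j jn e e0) => h + i; apply; rewrite sphi.
- have := IH (I * E)%type (fun p => p.2 :: phi p.1) j.+1.
  rewrite addnS -addSn => /(_ mj) H.
  apply: (@family_diffn_reindex _ _ _ _ _ _ _ _ _ (fun p : I * E => p)
    _ (H _)) => [p|i] /=; first by rewrite big_cons mulrC.
  by rewrite sphi.
Qed.

(** The head of the list is the direction of the last differentiation, as in the clause of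
    [cont_diffn] on [D x (h :: vs)]. Since [family_diffn] unfolds the first differentiation, the
    inductions below peel lists from the end. *)
Definition iter_derive (f : E -> R) (vs : seq E) : E -> R :=
  foldr (fun v g x => 'D_v g x) f vs.

Lemma eq_iter_derive (A : set E) (f g : E -> R) vs : open A ->
  (forall x, A x -> f x = g x) ->
  forall x, A x -> iter_derive f vs x = iter_derive g vs x.
Proof.
by move=> oA fg; elim: vs => //= v vs IH x Ax; exact: eq_derive_open Ax.
Qed.

Lemma iter_derive_rcons f vs v :
  iter_derive f (rcons vs v) = iter_derive (fun x => 'D_v f x) vs.
Proof. by rewrite /iter_derive foldr_rcons. Qed.

Lemma iter_deriveD (A : set E) n (I : Type) (w : I -> R) (f : I -> E -> R)
    (a : R) i j vs x :
  open A -> (forall i, 0 <= w i) -> family_diffn A n w f ->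
  (size vs <= n)%N -> A x ->
  iter_derive (fun y => a * f i y + f j y) vs x =
    a * iter_derive (f i) vs x + iter_derive (f j) vs x.
Proof.
move=> oA; elim: n I w f i j vs x => [|n IH] I w f i j vs x w0 Hf.
  by rewrite leqn0 => /nilP ->.
case/lastP: vs => [//|vs v]; rewrite size_rcons ltnS => sn Ax.
rewrite !iter_derive_rcons.
have [_ [_ _ Hff]] := Hf.
rewrite -(IH _ _ _ (i, v) (j, v) vs x _ Hff)//=; last first.
  by move=> p; rewrite mulr_ge0.
apply: eq_iter_derive Ax => // y Ay.
have Hi := family_diffn_is_derive w0 i v Hf Ay.
have Hj := family_diffn_is_derive w0 j v Hf Ay.
by have [_ ->] := is_deriveD (is_deriveZ a Hi) Hj.
Qed.

(** When the combination is the last vector, linearity of the innermost derivative is carried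
    through the outer ones by [iter_deriveD]; otherwise the last vector is absorbed into the
    family. *)
Lemma iter_derive_multilinear (A : set E) n (I : Type) (w : I -> R)
    (f : I -> E -> R) i (s1 s2 : seq E) (a : R) (u v : E) x :
  open A -> (forall i, 0 <= w i) -> family_diffn A n w f ->
  (size s1 + size s2 < n)%N -> A x ->
  iter_derive (f i) (s1 ++ (a *: u + v) :: s2) x =
    a * iter_derive (f i) (s1 ++ u :: s2) x +
    iter_derive (f i) (s1 ++ v :: s2) x.
Proof.
move=> oA; elim: n I w f i s2 => [//|n IH] I w f i s2 w0 Hf.
have [_ [Hl _ Hff]] := Hf.
have wE0 (p : I * E) : 0 <= w p.1 * `|p.2| by rewrite mulr_ge0.
case/lastP: s2 => [|s2 z] sn Ax.
  rewrite addn0 ltnS in sn; rewrite !cats1 !iter_derive_rcons.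
  rewrite -(iter_deriveD a (i, u) (i, v) oA wE0 Hff)//=.
  by apply: eq_iter_derive Ax => // y Ay; exact: Hl.
rewrite -!rcons_cons -!rcons_cat !iter_derive_rcons.
apply: (IH _ _ _ (i, z) s2 wE0 Hff) => //.
by move: sn; rewrite size_rcons addnS ltnS.
Qed.

Lemma iter_derive_bounded (A : set E) n (I : Type) (w : I -> R)
    (f : I -> E -> R) x j :
  (forall i, 0 <= w i) -> family_diffn A n w f -> (j <= n)%N -> A x ->
  exists C : R, forall i vs, size vs = j ->
    `|iter_derive (f i) vs x| <= C * (w i * \prod_(v <- vs) `|v|).
Proof.
elim: n I w f j => [|n IH] I w f j w0 Hf jn Ax.
  have [C _ HC] := family_diffn_bounded w0 Hf Ax.
  exists C => i vs; move: jn; rewrite leqn0 => /eqP -> /size0nil ->.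
  by rewrite big_nil mulr1; exact: HC.
case: j jn => [_|j jn].
  have [C _ HC] := family_diffn_bounded w0 Hf Ax.
  by exists C => i vs /size0nil ->; rewrite big_nil mulr1; exact: HC.
have [_ [_ _ Hff]] := Hf.
have wE0 (p : I * E) : 0 <= w p.1 * `|p.2| by rewrite mulr_ge0.
have [C HC] := IH _ _ _ j wE0 Hff jn Ax.
exists C => i; case/lastP => [//|vs v]; rewrite size_rcons => -[sv].
rewrite iter_derive_rcons (le_trans (HC (i, v) vs sv))//= big_rcons /=.
by rewrite -mulrA [X in _ <= _ * (_ * X)]mulrC.
Qed.

Lemma iter_derive_differentiable (A : set E) n (I : Type) (w : I -> R)
    (f : I -> E -> R) x j (e : R) :
  open A -> (forall i, 0 <= w i) -> family_diffn A n w f -> (j < n)%N ->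
  A x -> 0 < e ->
  \forall h \near (0 : E), forall i vs, size vs = j ->
    `|iter_derive (f i) vs (x + h) - iter_derive (f i) vs x -
      iter_derive (f i) (h :: vs) x| <=
    e * `|h| * (w i * \prod_(v <- vs) `|v|).
Proof.
move=> oA; elim: n I w f j => [//|n IH] I w f j w0 Hf jn Ax e0.
have [_ [_ Hd Hff]] := Hf.
case: j jn => [_|j jn].
  apply: filterS (Hd x Ax e e0) => h H i vs /size0nil ->.
  by rewrite big_nil mulr1 /=; exact: H.
have wE0 (p : I * E) : 0 <= w p.1 * `|p.2| by rewrite mulr_ge0.
apply: filterS (IH _ _ _ j wE0 Hff jn Ax e0) => h H i.
case/lastP => [//|vs v]; rewrite size_rcons => -[sv].
rewrite -rcons_cons !iter_derive_rcons (le_trans (H (i, v) vs sv))//=.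
by rewrite big_rcons /= -(mulrA (w i)) [X in _ <= _ * (_ * X)]mulrC.
Qed.

Lemma iter_derive_continuous (A : set E) n (I : Type) (w : I -> R)
    (f : I -> E -> R) x (e : R) :
  (forall i, 0 <= w i) -> family_diffn A n w f -> A x -> 0 < e ->
  \forall h \near (0 : E), forall i vs, size vs = n ->
    `|iter_derive (f i) vs (x + h) - iter_derive (f i) vs x| <=
    e * (w i * \prod_(v <- vs) `|v|).
Proof.
elim: n I w f => [|n IH] I w f w0 Hf Ax e0.
  have := family_diffn_equicontinuous w0 Hf Ax e0.
  apply: filterS => h H i vs /size0nil ->.
  by rewrite big_nil mulr1; exact: H.
have [_ [_ _ Hff]] := Hf.
have wE0 (p : I * E) : 0 <= w p.1 * `|p.2| by rewrite mulr_ge0.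
apply: filterS (IH _ _ _ wE0 Hff Ax e0) => h H i.
case/lastP => [//|vs v]; rewrite size_rcons => -[sv].
rewrite !iter_derive_rcons (le_trans (H (i, v) vs sv))//=.
by rewrite big_rcons /= -(mulrA (w i)) [X in _ <= _ * (_ * X)]mulrC.
Qed.

(** A function is a family with one member of weight 1. Forward, take lists of length 0 in
    [cont_diffn_family]; backward, iterated directional derivatives serve as D. *)
Lemma cont_diffnP (A : set E) n (f : E -> R) : open A ->
  cont_diffn n A f <-> family_diffn A n (fun _ : unit => 1) (fun=> f).
Proof.
move=> oA; split.
  move=> [D [D0 Dlin Dbnd Ddiff Dcont]].
  have := cont_diffn_family oA Dlin Dbnd Ddiff Dcont
    (phi := fun _ : unit => [::]) (addn0 n) (fun=> erefl).
  move=> /(@family_diffn_reindex _ _ _ _ _ _ _ (fun=> 1) _ id) H.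
  by apply: eq_family_diffn (H _) => // i; rewrite big_nil.
move=> Hf; have w0 (i : unit) : 0 <= 1 :> R by exact: ler01.
exists (fun x vs => iter_derive f vs x); split => //.
- move=> x Ax s1 s2 a u v sn.
  exact: (iter_derive_multilinear tt a u v oA w0 Hf sn Ax).
- move=> x Ax j jn; have [C HC] := iter_derive_bounded w0 Hf jn Ax.
  by exists C => vs sv; have := HC tt vs sv; rewrite mul1r.
- move=> x Ax j jn e e0.
  apply: filterS (iter_derive_differentiable oA w0 Hf jn Ax e0) => h H vs sv.
  by have := H tt vs sv; rewrite mul1r.
- move=> x Ax e e0; apply/near_add0.
  apply: filterS (iter_derive_continuous w0 Hf Ax e0) => h H vs sv.
  by have := H tt vs sv; rewrite mul1r.
Qed.

(** Local data give a different D on each neighbourhood; the family formulation, which mentions only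
    directional derivatives, avoids having to glue them. *)
Lemma cont_diffn_local (A : set E) n (f : E -> R) : open A ->
  (forall x, A x -> exists V g, [/\ open V, V x,
    forall y, V y -> f y = g y & cont_diffn n V g]) ->
  cont_diffn n A f.
Proof.
move=> oA H; apply/cont_diffnP => //; apply: family_diffn_local => x Ax.
have [V [g [oV Vx fg Hg]]] := H x Ax.
exists V => //; move/(cont_diffnP _ _ oV) : Hg; apply: eq_family_diffn => //.
by move=> _ y Vy; rewrite fg.
Qed.

End iterated_directional_derivatives.

(** * The smooth maximum and its effect on convexity in one variable *)

Section smooth_maximum.
Variable R : realType.
Implicit Types (e x y : R).
Local Open Scope convex_scope.

Definition smax e x y : R := x + e * chi (1 + (y - x) / e).

Lemma smax_gel e x y : 0 < e -> x <= smax e x y.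
Proof. by move=> e0; rewrite lerDl mulr_ge0 ?chi_ge0// ltW. Qed.

Lemma smax_ger e x y : 0 < e -> y <= smax e x y.
Proof.
move=> e0; have := chi_ge_sub1 (1 + (y - x) / e).
rewrite addrAC subrr add0r -(ler_pM2l e0) mulrCA divff ?gt_eqF// mulr1.
by rewrite /smax; lra.
Qed.

Lemma smax_le e x y z : 0 < e -> x <= z -> y + e <= z -> smax e x y <= z.
Proof.
move=> e0 xz yz; have := chi_le_max (1 + (y - x) / e).
have E : e * (1 + (y - x) / e) = e + (y - x).
  by rewrite mulrDr mulr1 mulrCA divff ?gt_eqF// mulr1.
by rewrite le_max => /orP[] /(ler_wpM2l (ltW e0)); rewrite ?mulr0 ?E /smax; lra.
Qed.

Lemma smax_eql e x y : 0 < e -> y + e <= x -> smax e x y = x.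
Proof.
by move=> e0 yx; apply/le_anti; rewrite smax_gel// smax_le.
Qed.

(** The tangent to [chi] at s, read in the variables x and y; its slope is the weight l. *)
Lemma smax_supporting_plane e x y : 0 < e ->
  exists l k, [/\ 0 <= l <= 1, smax e x y = (1 - l) * x + l * y + k &
    forall x' y', (1 - l) * x' + l * y' + k <= smax e x' y'].
Proof.
move=> e0; set s := 1 + (y - x) / e.
exists (dchi 1 s), (smax e x y - (1 - dchi 1 s) * x - dchi 1 s * y).
split; [exact: dchi1_itv|by ring|move=> x' y'].
have := chi_tangent s (1 + (y' - x') / e).
rewrite -(ler_pM2l e0) => H; rewrite -lerBlDl; apply: le_trans H.
rewrite le_eqVlt; apply/orP; left; apply/eqP; rewrite /smax -/s.
by move: (dchi 1 s) (chi s) => d c; rewrite /s; field; rewrite gt_eqF.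
Qed.

Lemma smaxB e x y c : smax e (x - c) (y - c) = smax e x y - c.
Proof. by rewrite /smax opprB addrA subrK addrAC. Qed.

(** Take the plane supporting [smax] at (f z, g z): its weights are nonnegative, so convexity of f
    and g bounds its value there by the average of its values at the end points, where it lies below
    [smax]. *)
Lemma convex_function_smax e (D : set R) (f g : R -> R) : 0 < e ->
  convex_function (D : set R^o) f -> convex_function (D : set R^o) g ->
  convex_function (D : set R^o) (fun x => smax e (f x) (g x)).
Proof.
move=> e0 cf cg t x y xD yD.
set z := x <| t |> y; pose p := t%:num.
have p0 : 0 <= p by rewrite /p ge0.
have p1 : 0 <= 1 - p by rewrite subr_ge0 /p le1.
have fz : f z <= p * f x + (1 - p) * f y := cf t x y xD yD.
have gz : g z <= p * g x + (1 - p) * g y := cg t x y xD yD.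
rewrite -[leRHS]/(p * smax e (f x) (g x) + (1 - p) * smax e (f y) (g y)).
have [l [k [/andP[l0 l1] -> H]]] := smax_supporting_plane (f z) (g z) e0.
have l1' : 0 <= 1 - l by rewrite subr_ge0.
have Hx := ler_wpM2l p0 (H (f x) (g x)).
have Hy := ler_wpM2l p1 (H (f y) (g y)).
rewrite (le_trans _ (lerD Hx Hy))//.
have Hf := ler_wpM2l l1' fz; have Hg := ler_wpM2l l0 gz.
rewrite (le_trans (lerD (lerD Hf Hg) (lexx k)))//.
by rewrite le_eqVlt; apply/orP; left; apply/eqP; ring.
Qed.

(** With l = chi' (s t), one has m'' = (1 - l) a'' + l b'' + chi'' (s t) (b' - a')^2 / e: a convex
    combination of positive numbers plus a nonnegative term. *)
Lemma smax_second_derivative e (a b : R -> R) t : 0 < e ->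
  (\forall s \near t, derivable a s 1) -> derivable a^`() t 1 -> 0 < a^`(2) t ->
  (\forall s \near t, derivable b s 1) -> derivable b^`() t 1 -> 0 < b^`(2) t ->
  let m s := smax e (a s) (b s) in
  [/\ \forall s \near t, derivable m s 1, derivable m^`() t 1 & 0 < m^`(2) t].
Proof.
move=> e0 da dda a0 db ddb b0 m.
pose s u := 1 + (b u - a u) / e.
have ds u : derivable a u 1 -> derivable b u 1 ->
    is_derive u 1 s ((derive1 b u - derive1 a u) / e).
  move=> /derivableP au /derivableP bu.
  have H := is_deriveD (is_derive_cst (1 : R) u (1 : R))
    (is_deriveZ e^-1 (is_deriveB bu au)).
  have -> : s = cst 1 + e^-1 *: (b - a).
    by apply/funext => v; rewrite /s mulrC.
  by apply: (is_derive_eq H); rewrite !derive1E add0r mulrC.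
have dm u : derivable a u 1 -> derivable b u 1 ->
    is_derive u 1 m (derive1 a u + dchi 1 (s u) * (derive1 b u - derive1 a u)).
  move=> au bu; have iau := derivableP au.
  have H := is_deriveD iau
    (is_deriveZ e (is_derive1_comp (is_derive_dchi 0 (s u)) (ds u au bu))).
  apply: (is_derive_eq H); rewrite -derive1E -[_ *: _]/(_ * _).
  by field; rewrite gt_eqF.
have dat := nbhs_singleton da; have dbt := nbhs_singleton db.
have dm1 : \forall u \near t,
    derive1 m u = derive1 a u + dchi 1 (s u) * (derive1 b u - derive1 a u).
  by apply: filterS2 da db => u au bu; rewrite derive1E; have [] := dm u au bu.
have dm2 : is_derive t 1 (derive1 m) (derive1n 2 a t +
    dchi 1 (s t) * (derive1n 2 b t - derive1n 2 a t) +
    dchi 2 (s t) * ((derive1 b t - derive1 a t) ^+ 2 / e)).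
  have H := is_deriveD (derivableP dda)
    (is_deriveM (is_derive1_comp (is_derive_dchi 1 (s t)) (ds t dat dbt))
      (is_deriveB (derivableP ddb) (derivableP dda))).
  have nE : \forall u \near t,
      (derive1 a + (dchi 1 \o s) * (derive1 b - derive1 a)) u = derive1 m u.
    by apply: filterS dm1 => u ->.
  apply: is_derive_eq (near_eq_is_derive nE H) _.
  rewrite -[derive1n 2 b]/(derive1 (derive1 b)).
  rewrite -[derive1n 2 a]/(derive1 (derive1 a)).
  rewrite -[LHS]/('D_1 (derive1 a) t +
    (dchi 1 (s t) * ('D_1 (derive1 b) t - 'D_1 (derive1 a) t) +
     (derive1 b t - derive1 a t) *
     (dchi 2 (s t) * ((derive1 b t - derive1 a t) / e)))).
  rewrite -!(derive1E (derive1 _)).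
  move: (dchi 1 (s t)) (dchi 2 (s t)) (derive1 (derive1 a) t)
    (derive1 (derive1 b) t) (derive1 a t) (derive1 b t) => l k a2 b2 a1 b1.
  by ring.
split.
- by apply: filterS2 da db => u au bu; have [] := dm u au bu.
- by have [] := dm2.
- rewrite -[derive1n 2 m]/(derive1 (derive1 m)) derive1E; have [_ ->] := dm2.
  have /andP[l0 l1] := dchi1_itv (s t).
  have c0 : 0 <= dchi 2 (s t) * ((derive1 b t - derive1 a t) ^+ 2 / e).
    by rewrite mulr_ge0 ?dchi2_ge0// divr_ge0 ?sqr_ge0// ltW.
  rewrite ltr_pwDl//; move: l0 l1 a0 b0.
  move: (dchi 1 (s t)) (derive1n 2 a t) (derive1n 2 b t) => l p q l0 l1 p0 q0.
  (* For l < 1 the term (1 - l) p is positive; for l = 1 only q remains. *)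
  have [->|l10] := eqVneq l 1; first by lra.
  have : 0 < (1 - l) * p by rewrite mulr_gt0// subr_gt0 lt_neqAle l10.
  have : 0 <= l * q by rewrite mulr_ge0// ltW.
  by lra.
Qed.

End smooth_maximum.

(** * Stability of C^k functions under the smooth maximum *)

Section smooth_functions.
Variables (R : realType) (E : normedModType R).

Lemma cont_diffn_comp (A : set E) n (c : nat -> R -> R) (u : E -> R) k :
  open A -> (forall k (s : R), is_derive s 1 (c k) (c k.+1 s)) ->
  cont_diffn n A u -> cont_diffn n A (fun x => c k (u x)).
Proof.
move=> oA Hc /(cont_diffnP _ _ oA) Hu; apply/(cont_diffnP _ _ oA).
exact: family_diffn_comp.
Qed.

Lemma cont_diffnD (A : set E) n (f g : E -> R) : open A ->
  cont_diffn n A f -> cont_diffn n A g -> cont_diffn n A (fun x => f x + g x).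
Proof.
move=> oA /(cont_diffnP _ _ oA) Hf /(cont_diffnP _ _ oA) Hg.
by apply/(cont_diffnP _ _ oA); exact: family_diffnD.
Qed.

Lemma cont_diffn_affine (A : set E) n (f : E -> R) (a b : R) : open A ->
  cont_diffn n A f -> cont_diffn n A (fun x => a * f x + b).
Proof.
move=> oA; pose c k (s : R) : R :=
  match k with 0 => a * s + b | 1 => a | _ => 0 end.
apply: (@cont_diffn_comp A n c f 0 oA) => -[|[|k]] s.
- have H := is_deriveD (is_deriveZ a (is_derive_id s (1 : R)))
    (is_derive_cst b s (1 : R)).
  by apply: (is_derive_eq H); rewrite addr0 -[_ *: _]/(_ * _) mulr1.
- exact: is_derive_cst.
- exact: is_derive_cst.
Qed.

Lemma cont_diff_smax k (A : set E) (g h : E -> R) (e : R) : open A ->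
  cont_diff k A g -> cont_diff k A h ->
  cont_diff k A (fun x => smax e (g x) (h x)).
Proof.
move=> oA.
have H n : cont_diffn n A g -> cont_diffn n A h ->
    cont_diffn n A (fun x => smax e (g x) (h x)).
  move=> Hg Hh.
  have Hs := cont_diffnD oA (cont_diffn_affine e^-1 1 oA Hh)
    (cont_diffn_affine (- e^-1) 0 oA Hg).
  have := cont_diffnD oA Hg (cont_diffn_affine e 0 oA
    (cont_diffn_comp 0 oA (@is_derive_dchi R) Hs)).
  congr (cont_diffn n A _); apply/funext => x; rewrite /smax addr0.
  by congr (_ + _ * chi _); ring.
by case: k => [n|] /=; [exact: H|move=> Hg Hh n; exact: H].
Qed.

Lemma cont_diff_local k (A : set E) (f : E -> R) : open A ->
  (forall x, A x -> exists V g, [/\ open V, V x,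
    forall y, V y -> f y = g y & cont_diff k V g]) ->
  cont_diff k A f.
Proof.
move=> oA; case: k => [n|] /= H; first exact: cont_diffn_local.
move=> n; apply: cont_diffn_local => // x /H[V [g [oV Vx fg Hg]]].
by exists V, g; split.
Qed.

End smooth_functions.

(** * Smoothness and convexity in the ambient spaces *)

Lemma convex_functionP (R : realType) (D : set R) (f : R -> R) :
  convex_function (D : set R^o) f <->
  (forall (t : {i01 R}) x y, D x -> D y ->
    f (t%:num * x + (1 - t%:num) * y) <=
      t%:num * f x + (1 - t%:num) * f y).
Proof.
split=> H t x y Dx Dy; first by apply: H; rewrite inE.
by apply: H; rewrite -inE.
Qed.

Lemma segment_conv (R : realType) (a b : R) (t : {i01 R}) x y :
  `[a, b]%classic x -> `[a, b]%classic y ->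
  `[a, b]%classic (t%:num * x + (1 - t%:num) * y).
Proof.
have p0 : 0 <= t%:num by rewrite ge0.
have p1 : 0 <= 1 - t%:num by rewrite subr_ge0 le1.
move: (t%:num) p0 p1 => p p0 p1.
rewrite /= !in_itv /= => /andP[ax xb] /andP[ay yb].
have := ler_wpM2l p0 ax; have := ler_wpM2l p0 xb.
have := ler_wpM2l p1 ay; have := ler_wpM2l p1 yb.
by move=> ? ? ? ?; apply/andP; split; lra.
Qed.

Section ambient_spaces.
Variables (R : realType) (X : ambient R).
Implicit Types (A V W U : set X) (f g h : X -> R).

Lemma open_chart_preimage (M : riemannian_manifold R) i (A : set M) :
  open A -> open (cod i `&` (chart_inv (r := M) i) @^-1` A).
Proof.
move=> oA; rewrite openE => x [cx Ax].
have oc := @cod_open _ M i.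
have cC : {for x, continuous (@chart_inv _ M i)}.
  have := @chart_inv_continuous _ M i; rewrite continuous_open_subspace//.
  by apply; rewrite inE.
apply: filterI; first exact: open_nbhs_nbhs.
by apply: cC; exact: open_nbhs_nbhs.
Qed.

Lemma Ck_smax k A g h (e : R) : open A -> Ck k A g -> Ck k A h ->
  Ck k A (fun x => smax e (g x) (h x)).
Proof.
case: X A g h => [n|M|E] /= A g h oA; first exact: cont_diff_smax.
  move=> Hg Hh i; apply: cont_diff_smax (Hg i) (Hh i).
  exact: open_chart_preimage.
exact: cont_diff_smax.
Qed.

Lemma Ck_local k A f : open A ->
  (forall x, A x -> exists V g, [/\ open V, V x,
    forall y, V y -> f y = g y & Ck k V g]) ->
  Ck k A f.
Proof.
case: X A f => [n|M|E] /= A f oA H; first exact: cont_diff_local.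
  move=> i; apply: cont_diff_local; first exact: open_chart_preimage.
  move=> x [cx Ax]; have [V [g [oV Vx fg Hg]]] := H _ Ax.
  exists (cod i `&` (chart_inv (r := M) i) @^-1` V), (g \o chart_inv i).
  split => //; first exact: open_chart_preimage.
  by move=> y [_ Vy]; exact: fg.
exact: cont_diff_local.
Qed.

Lemma geodesic_continuous a b (gamma : R -> X) t : geodesic a b gamma ->
  `[a, b]%classic t -> {for t, continuous gamma}.
Proof.
have line (E : normedModType R) (g : R -> E) :
    (exists x v : E, forall t, g t = x + t *: v) -> {for t, continuous g}.
  move=> [x [v gE]]; have -> : g = (fun t => x + t *: v) by apply/funext.
  by apply: cvgD; [exact: cvg_cst|apply: cvgZr_tmp; exact: cvg_id].
case: X gamma => [n|M|E] /= gamma; [by move=> /line| |by move=> /line].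
by move=> H /H /nbhs_singleton[].
Qed.

Lemma convex_on_sub U W f : W `<=` U -> convex_on U f -> convex_on W f.
Proof.
by move=> WU cf a b gamma geo HW; apply: cf => // t /HW; exact: WU.
Qed.

Lemma convex_on_smax U g h (e : R) : 0 < e ->
  convex_on U g -> convex_on U h -> convex_on U (fun x => smax e (g x) (h x)).
Proof.
move=> e0 cg ch a b gamma geo HU.
exact: (convex_function_smax e0 (cg _ _ _ geo HU) (ch _ _ _ geo HU)).
Qed.

(** Along a geodesic that is not constant on [a, b] the second derivative is positive; along a
    constant one the inequality is an equality. *)
Lemma strongly_convex_C2_convex V (phi : X -> R) :
  strongly_convex_C2 V phi -> convex_on V phi.
Proof.
move=> sc a b gamma geo HV; apply/convex_functionP => t x y xD yD.
have [nc|cst] := pselect (exists s t, [/\ `[a, b]%classic s,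
    `[a, b]%classic t & gamma s <> gamma t]); last first.
  have E u v : `[a, b]%classic u -> `[a, b]%classic v -> gamma u = gamma v.
    by move=> uD vD; apply: contrapT => uv; apply: cst; exists u, v.
  rewrite /= (E _ x (segment_conv t xD yD) xD) (E y x yD xD).
  by rewrite -mulrDl subrKC mul1r.
have := sc _ _ _ geo HV nc.
move: (phi \o gamma) => f H.
have D1E : 'D_1 f = derive1 f by apply/funext => u; rewrite derive1E.
have df u : `[a, b]%classic u -> derivable f u 1.
  by move=> /H[/nbhs_singleton].
have cf u : `[a, b]%classic u -> {for u, continuous f}.
  by move=> /df /derivable1_diffP /differentiable_continuous.
have main (p : {i01 R}) u v : u <= v -> `[a, b]%classic u ->
    `[a, b]%classic v ->
    f (p%:num * u + (1 - p%:num) * v) <= p%:num * f u + (1 - p%:num) * f v.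
  move=> uv uD vD.
  have uvD w : u < w < v -> `[a, b]%classic w.
    move: uD vD; rewrite /= !in_itv /= => /andP[au _] /andP[_ vb] /andP[uw wv].
    by rewrite (le_trans au (ltW uw)) (le_trans (ltW wv) vb).
  apply: (@second_derivative_convex R f u v _ _ _ _ _ p uv).
  - move=> w /uvD /H[_ _]; rewrite -[derive1n 2 f]/(derive1 (derive1 f)).
    by rewrite derive1E D1E => /ltW.
  - exact: (cvg_at_left_filter (cf _ vD)).
  - exact: (cvg_at_right_filter (cf _ uD)).
  - by move=> w; rewrite in_itv => /uvD /df.
  - by move=> w; rewrite in_itv D1E => /uvD /H[].
have [xy|/ltW yx] := leP x y; first exact: main.
have := main (1 - t%:num)%:i01 y x yx yD xD.
rewrite /= subKr addrC [leRHS]addrC. exact.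
Qed.

Lemma strongly_convex_C2_smax U g h (e : R) : 0 < e ->
  strongly_convex_C2 U g -> strongly_convex_C2 U h ->
  strongly_convex_C2 U (fun x => smax e (g x) (h x)).
Proof.
move=> e0 sg sh a b gamma geo HU nc t tab.
have [g1 g2 g3] := sg _ _ _ geo HU nc t tab.
have [h1 h2 h3] := sh _ _ _ geo HU nc t tab.
exact: (@smax_second_derivative R e (g \o gamma) (h \o gamma) t e0
  g1 g2 g3 h1 h2 h3).
Qed.

(** The smaller of the two constants serves for both functions, and subtracting a multiple of phi
    from both arguments commutes with [smax]. *)
Lemma strongly_convex_weak_smax U g h (e : R) : 0 < e ->
  strongly_convex_weak U g -> strongly_convex_weak U h ->
  strongly_convex_weak U (fun x => smax e (g x) (h x)).
Proof.
move=> e0 sg sh p Up V phi oV Vp Cphi sphi.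
have [a [a0 [W [oW Wp WUV cW]]]] := sg p Up V phi oV Vp Cphi sphi.
have [b [b0 [W' [oW' W'p W'UV cW']]]] := sh p Up V phi oV Vp Cphi sphi.
(* f - d phi = (f - c phi) + (c - d) phi, and phi is convex. *)
have shrink f c d W0 : d <= c -> W0 `<=` V ->
    convex_on W0 (fun x => f x - c * phi x) ->
    convex_on W0 (fun x => f x - d * phi x).
  move=> dc W0V cf x y gamma geo HW; apply/convex_functionP => t u v uD vD.
  have cphi := convex_on_sub W0V (strongly_convex_C2_convex sphi).
  have /convex_functionP/(_ t u v uD vD) H1 := cf _ _ _ geo HW.
  have /convex_functionP/(_ t u v uD vD) H2 := cphi _ _ _ geo HW.
  have cd : 0 <= c - d by rewrite subr_ge0.
  move: H1 (ler_wpM2l cd H2) => /=.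
  by move: (t%:num) => q; lra.
exists (Num.min a b); split; first by rewrite lt_min a0.
exists (W `&` W'); split => //; first exact: openI.
  by move=> x [/WUV].
have -> : (fun x => smax e (g x) (h x) - Num.min a b * phi x) =
    (fun x => smax e (g x - Num.min a b * phi x) (h x - Num.min a b * phi x)).
  by apply/funext => x; rewrite smaxB.
apply: convex_on_smax => //.
- apply: (@shrink _ a); first by rewrite ge_min lexx.
    by move=> x [/WUV[]].
  by apply: convex_on_sub cW => x [].
- apply: (@shrink _ b); first by rewrite ge_min lexx orbT.
    by move=> x [/WUV[]].
  by apply: convex_on_sub cW' => x [].
Qed.

Lemma Ck_convex_smax c k U g h (e : R) : open U -> 0 < e ->
  Ck_convex c k U g -> Ck_convex c k U h ->
  Ck_convex c k U (fun x => smax e (g x) (h x)).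
Proof.
move=> oU e0 [Cg cg] [Ch ch]; split; first exact: Ck_smax.
case: c cg ch => [|]; first exact: convex_on_smax.
case: k {Cg Ch} => [[|[|k]]|]; [exact: strongly_convex_weak_smax..|
  exact: strongly_convex_C2_smax|exact: strongly_convex_C2_smax].
Qed.

(** Smoothness and strong convexity are local, and g agrees with [g_ n] on the open set B n;
    convexity compares three points, which lie in a common B n. *)
Lemma Ck_convex_bigcup c k U (B : nat -> set X) g (g_ : nat -> X -> R) :
  open U -> U = \bigcup_n B n -> (forall n, open (B n)) ->
  (forall n, B n `<=` B n.+1) -> (forall n x, B n x -> g x = g_ n x) ->
  (forall n, Ck_convex c k U (g_ n)) -> Ck_convex c k U g.
Proof.
move=> oU UE oB Bm gE Hg.
have BU n : B n `<=` U by rewrite UE => x; exists n.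
have UB x : U x -> exists n, B n x by rewrite UE => -[n]; exists n.
have Bmono m n : (m <= n)%N -> B m `<=` B n.
  elim: n => [|n IH]; first by rewrite leqn0 => /eqP ->.
  by rewrite leq_eqVlt => /predU1P[-> //|/IH mn x /mn]; exact: Bm.
split.
  apply: Ck_local => // x /UB[n Bx]; exists (B n), (g_ n).
  split => //; first exact: gE.
  (* Locality again, now to restrict [g_ n] from U to B n. *)
  apply: Ck_local => // y By; exists U, (g_ n); split => //; first exact: BU By.
  by have [] := Hg n.
case: c Hg => Hg.
  move=> a b gamma geo HU; apply/convex_functionP => t x y xD yD.
  have [i Bx] := UB _ (HU _ xD); have [j By] := UB _ (HU _ yD).
  have [k' Bz] := UB _ (HU _ (segment_conv t xD yD)).
  (* The geodesic may leave B n between these points: [g_ n] is convex on all of U. *)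
  pose n := maxn i (maxn j k'); have [_ cn] := Hg n.
  have xn : B n (gamma x) by apply: (Bmono i) Bx; rewrite !leq_max leqnn.
  have yn : B n (gamma y).
    by apply: (Bmono j) By; rewrite !leq_max leqnn orbT.
  have zn : B n (gamma (t%:num * x + (1 - t%:num) * y)).
    by apply: (Bmono k') Bz; rewrite !leq_max leqnn !orbT.
  have /convex_functionP/(_ t x y xD yD) := cn _ _ _ geo HU.
  by rewrite /= !(gE n).
have weak : (forall n, strongly_convex_weak U (g_ n)) ->
    strongly_convex_weak U g.
  move=> sg p /[dup] Up /UB[n Bp] V phi oV Vp Cphi sphi.
  have [a [a0 [W [oW Wp WUV cW]]]] := sg n p Up V phi oV Vp Cphi sphi.
  exists a; split => //; exists (W `&` B n); split => //; first exact: openI.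
    by move=> x [/WUV].
  have cWB := convex_on_sub (@subIsetl _ W (B n)) cW.
  move=> x y gamma geo HW; apply/convex_functionP => t u v uD vD.
  have /convex_functionP/(_ t u v uD vD) := cWB _ _ _ geo HW.
  have gW w : `[x, y]%classic w -> g (gamma w) = g_ n (gamma w).
    by move=> /HW[_ /gE].
  by rewrite /= !gW//; exact: segment_conv.
have C2 : (forall n, strongly_convex_C2 U (g_ n)) -> strongly_convex_C2 U g.
  move=> sg a b gamma geo HU nc t tab.
  have [n Bt] := UB _ (HU t tab).
  have gc := geodesic_continuous geo tab.
  have := sg n _ _ _ geo HU nc t tab.
  have : \forall s \near t, (g \o gamma) s = (g_ n \o gamma) s.
    have : nbhs t (gamma @^-1` B n) by apply: gc; exact: open_nbhs_nbhs.
    by apply: filterS => s /gE.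
  move: (g \o gamma) (g_ n \o gamma) => G F GF [dF ddF F0].
  have GF2 : \forall s \near t, derive1 G s = derive1 F s.
    have := near_join GF; apply: filterS => s sGF; rewrite !derive1E.
    exact: near_eq_derive.
  split.
  - have := near_join GF; apply: filterS2 dF => s dFs sGF.
    apply: (@near_eq_derivable _ _ _ F) => //.
    by apply: filterS sGF => u ->.
  - apply: (@near_eq_derivable _ _ _ (derive1 F)) => //.
    by apply: filterS GF2 => u ->.
  - move: F0; rewrite -[derive1n 2 F]/(derive1 (derive1 F)).
    rewrite -[derive1n 2 G]/(derive1 (derive1 G)) !derive1E.
    by rewrite (near_eq_derive _ GF2).
case: k Hg => [[|[|k]]|] Hg; [apply: weak|apply: weak|apply: C2|apply: C2];
  by move=> n; have [] := Hg n.
Qed.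

End ambient_spaces.

(** * Gluing the approximations along the exhaustion *)

Theorem theorem2 (R : realType) (X : ambient R) (U : set X)
  (k : option nat) (c : convexity)
  (U_open : open U) (U_convex : geodesically_convex U)
  (B : nat -> set X)
  (U_eq : U = \bigcup_n B n)
  (B_open : forall n, open (B n))
  (B_bounded : forall n, bounded_subset (B n))
  (B_convex : forall n, geodesically_convex (B n))
  (B_dist : forall n, (0 < set_dist (B n) (frontier U))%E)
  (B_nested : forall n, closure (B n) `<=` B n.+1)
  (approx_bounded : forall f : X -> R,
    {within U, continuous f} -> convex_on U f ->
    approximable_from_below_on_bounded c k U f) :
  forall f : X -> R,
    {within U, continuous f} -> convex_on U f ->
    approximable_from_below_uniformly c k U f.
Proof.
move=> f cf convf e e0.
have Bm n : B n `<=` B n.+1 by move=> x /(@subset_closure _ _) /B_nested.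
have Bmono m n : (m <= n)%N -> B m `<=` B n.
  elim: n => [|n IH]; first by rewrite leqn0 => /eqP ->.
  by rewrite leq_eqVlt => /predU1P[-> //|/IH mn x /mn]; exact: Bm.
have BU n : B n `<=` U by rewrite U_eq => x; exists n.
pose q n : R := e / 2 ^+ n.
have q0 n : 0 < q n by rewrite divr_gt0// exprn_gt0.
have qS n : q n = 2 * q n.+1.
  by rewrite /q exprS; field; rewrite expf_neq0.
have /choice[h hP] n : exists h, [/\ Ck_convex c k U h,
    forall x, U x -> h x <= f x - (e - q n) &
    forall x, B n x -> f x - (e - q n) - q n / 4 <= h x].
  apply: (approx_bounded (fun x => f x - (e - q n))) => //.
  - by move=> x; apply: cvgB; [exact: cf|exact: cvg_cst].
  - move=> a b gamma geo HU; apply/convex_functionP => t x y xD yD.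
    have /convex_functionP/(_ t x y xD yD) /= := convf _ _ _ geo HU.
    by move: (t%:num) => p; lra.
  - by rewrite divr_gt0.
pose g_ := fix g_ n : X -> R := if n is m.+1
  then fun x => smax (q m / 4) (g_ m x) (h m.+1 x) else h 0.
have q4 n : 0 < q n / 4 by rewrite divr_gt0.
have g_C n : Ck_convex c k U (g_ n).
  elim: n => [|n IH] /=; first by have [] := hP 0.
  have [hC _ _] := hP n.+1.
  exact: (@Ck_convex_smax R X c k U (g_ n) (h n.+1) (q n / 4)).
have hg n x : h n x <= g_ n x by case: n => [//|n] /=; exact: smax_ger.
(* The shift e - q n vanishes at n = 0. Afterwards h (n + 1) + q n / 4 <= f - e + (3/4) q n <= f,
   because q n <= e. *)
have g_f n x : U x -> g_ n x <= f x.
  move=> Ux; elim: n => [|n IH] /=.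
    by have [_ /(_ x Ux) + _] := hP 0; rewrite /q expr0 divr1 subrr subr0.
  apply: smax_le => //; have [_ /(_ x Ux) + _] := hP n.+1.
  have := q0 n.+1; have := qS n; have : q n <= e; last by lra.
  rewrite /q ler_pdivrMr ?exprn_gt0// ler_peMr ?(ltW e0)//.
  by rewrite exprn_ege1// ler1n.
(* On B n, h n >= f - e + (3/4) q n, while h (n + 1) <= f - e + q n / 2: the gap is exactly the
   margin q n / 4 required by [smax_eql]. *)
have g_S n x : B n x -> g_ n.+1 x = g_ n x.
  move=> Bx /=; apply: smax_eql => //; apply: le_trans (hg n x).
  have [_ _ /(_ x Bx)] := hP n; have [_ /(_ x (BU _ _ Bx)) + _] := hP n.+1.
  by have := qS n; lra.
have g_E m n x : (m <= n)%N -> B m x -> g_ n x = g_ m x.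
  move=> + Bx; elim: n => [|n IH]; first by rewrite leqn0 => /eqP ->.
  rewrite leq_eqVlt => /predU1P[-> //|]; rewrite ltnS => mn.
  by rewrite g_S ?IH//; exact: Bmono Bx.
(* An arbitrary index n with x in B n, and 0 when there is none; [g_E] makes the value on U
   independent of the choice. *)
pose g x := g_ (xget 0 [set n | B n x]) x.
have gE n x : B n x -> g x = g_ n x.
  move=> Bx; rewrite /g; case: xgetP => [m _ /= Bmx|/(_ n)//].
  have [mn|/ltnW nm] := leqP m n; first by rewrite (g_E m n).
  by rewrite (g_E n m).
exists g; split; first exact: (Ck_convex_bigcup U_open U_eq B_open Bm gE g_C).
move=> x Ux; move: (Ux); rewrite {1}U_eq => -[n _ Bx].
(* The lower bound comes from h n <= [g_ n] and h n >= f - e + (3/4) q n on B n. *)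
rewrite (gE _ _ Bx) g_f// andbT (le_trans _ (hg n x))//.
have [_ _ /(_ x Bx)] := hP n; have := q0 n; lra.
Qed.
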